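(* Let $\mathfrak m$ be a multisegment such that for every $x\in\mathbb Z$ at most two segments of $\mathfrak m$, counted with multiplicity, have beginning $x$. Then: (1) if $\mathfrak m$ is distinguished, then $\mathfrak m$ is of Speh type; (2) if both $\mathfrak m$ and $\mathfrak m^\vee$ are distinguished, then $\mathfrak m$ is of Speh type.
   Context: A segment is a set $[a,b]=\{a,a+1,\ldots,b\}$ of consecutive integers, $a\le b$; write $\mathbf b([a,b])=a$ (beginning), $\mathbf e([a,b])=b$ (endpoint), and $\mathrm{Sgm}$ for the set of segments. Put $\nu[a,b]=[a+1,b+1]$ and $[a,b]^\vee=[-b,-a]$. A multisegment is a finitely supported function $\mathfrak m:\mathrm{Sgm}\to\mathbb Z_{\ge0}$ (a finite multiset of segments); sums are pointwise; $(\nu\mathfrak m)(\Delta)=\mathfrak m(\nu^{-1}\Delta)$ and $\mathfrak m^\vee(\Delta)=\mathfrak m(\Delta^\vee)$. An order of $\mathfrak m$ is a listing $(\Delta_1,\ldots,\Delta_k)$ in which each segment $\Delta$ occurs exactly $\mathfrak m(\Delta)$ times. Write $[a,b]\prec[a',b']$ if $a<a'$, $b<b'$ and $b\ge a'-1$. An order is standard if $\Delta_i\not\prec\Delta_j$ whenever $i<j$. A decomposition of a segment $\Delta$ is a tuple of segments $(\Delta_1,\ldots,\Delta_r)$, $r\ge1$, with $\mathbf e(\Delta_1)=\mathbf e(\Delta)$, $\mathbf b(\Delta_r)=\mathbf b(\Delta)$ and $\mathbf e(\Delta_{i+1})=\mathbf b(\Delta_i)-1$ for $1\le i\le r-1$.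 A decomposition of an order $(\Delta_1,\ldots,\Delta_k)$ is a choice of a decomposition $(\Delta_{i,1},\ldots,\Delta_{i,k_i})$ of each $\Delta_i$; its index set is $I=\{(i,j):1\le i\le k,\ 1\le j\le k_i\}$, ordered lexicographically ($\prec_{\mathrm{lex}}$), and $(i,j)\ll(i',j')$ means $i<i'$. The decomposition is relevant to the order if there is an involution $\tau:I\to I$ with: (R1) $\tau(i,j+1)\ll\tau(i,j)$ for all $1\le i\le k$, $1\le j\le k_i-1$; (R2) $\tau(\imath)\ne\imath$ for all $\imath\in I$; (R3) $\Delta_\imath=\nu\Delta_{\tau(\imath)}$ whenever $\imath\prec_{\mathrm{lex}}\tau(\imath)$. $\mathfrak m$ is distinguished if every standard order of $\mathfrak m$ admits a relevant decomposition. $\mathfrak m$ is of Speh type if $\mathfrak m=\mathfrak n+\nu\mathfrak n$ for some multisegment $\mathfrak n$. *)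

(* Defs.v *)
From HB Require Import structures.
From mathcomp Require Import all_boot all_order all_algebra.
From mathcomp Require Import finmap multiset.

Set Implicit Arguments.
Unset Strict Implicit.
Unset Printing Implicit Defensive.

Import Order.TTheory GRing.Theory Num.Theory.
Local Open Scope fset_scope.
Local Open Scope mset_scope.
Local Open Scope ring_scope.

(* The segment [a, b] of consecutive integers, with a <= b, is encoded by the
   pair (a, b) of its endpoints. *)
Record segment := Segment {
  seg_ends : int * int;
  _ : seg_ends.1 <= seg_ends.2
}.

HB.instance Definition _ := [isSub for seg_ends].
HB.instance Definition _ := [Choice of segment by <:].

Definition sbeg (D : segment) : int := (seg_ends D).1.
Definition send (D : segment) : int := (seg_ends D).2.

Lemma seg_le (D : segment) : sbeg D <= send D.
Proof. by case: D. Qed.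

Fact seg_shift_subproof (D : segment) : sbeg D + 1 <= send D + 1.
Proof. by rewrite lerD2r seg_le. Qed.

Definition seg_shift (D : segment) : segment :=
  @Segment (sbeg D + 1, send D + 1) (seg_shift_subproof D).

Fact seg_unshift_subproof (D : segment) : sbeg D - 1 <= send D - 1.
Proof. by rewrite lerD2r seg_le. Qed.

Definition seg_unshift (D : segment) : segment :=
  @Segment (sbeg D - 1, send D - 1) (seg_unshift_subproof D).

Fact seg_dual_subproof (D : segment) : - send D <= - sbeg D.
Proof. by rewrite lerN2 seg_le. Qed.

Definition seg_dual (D : segment) : segment :=
  @Segment (- send D, - sbeg D) (seg_dual_subproof D).

Lemma seg_shiftK : cancel seg_shift seg_unshift.
Proof. by case=> [[a b] ?]; apply: val_inj; rewrite /= !addrK. Qed.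

Lemma seg_unshiftK : cancel seg_unshift seg_shift.
Proof. by case=> [[a b] ?]; apply: val_inj; rewrite /= !subrK. Qed.

Lemma seg_dualK : involutive seg_dual.
Proof. by case=> [[a b] ?]; apply: val_inj; rewrite /= !opprK. Qed.

Definition seg_prec (D D' : segment) : bool :=
  [&& sbeg D < sbeg D', send D < send D' & sbeg D' - 1 <= send D].

Notation multisegment := {mset segment}.

Definition mseg_shift (m : multisegment) : multisegment :=
  seq_mset [seq seg_shift D | D <- m].

Lemma mseg_shiftE (m : multisegment) (D : segment) :
  mseg_shift m D = m (seg_unshift D).
Proof.
rewrite mset_seqE count_map -count_mem_mset; apply: eq_count => E /=.
exact: (can2_eq seg_shiftK seg_unshiftK).
Qed.

Definition mseg_dual (m : multisegment) : multisegment :=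
  seq_mset [seq seg_dual D | D <- m].

Lemma mseg_dualE (m : multisegment) (D : segment) :
  mseg_dual m D = m (seg_dual D).
Proof.
rewrite mset_seqE count_map -count_mem_mset; apply: eq_count => E /=.
exact: (can2_eq seg_dualK seg_dualK).
Qed.

Definition is_order (m : multisegment) (s : seq segment) : Prop :=
  forall D : segment, count_mem D s = m D.

Definition standard (s : seq segment) : bool :=
  pairwise (fun D D' => ~~ seg_prec D D') s.

(* The pieces of a decomposition are listed from the end of D down to its
   beginning. *)
Definition seg_decomp (D : segment) (ds : seq segment) : bool :=
  [&& ds != [::], send (head D ds) == send D, sbeg (last D ds) == sbeg D
    & sorted (fun E E' => send E' == sbeg E - 1) ds].

Definition order_decomp (s : seq segment) (d : 'I_(size s) -> seq segment) :
  Prop := forall i : 'I_(size s), seg_decomp (tnth (in_tuple s) i) (d i).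

(* Index pairs (i, j), both components counted from 0. *)
Definition dindex (k : nat) (d : 'I_k -> seq segment) : Type :=
  {i : 'I_k & 'I_(size (d i))}.

Definition drow (k : nat) (d : 'I_k -> seq segment) (x : dindex d) : nat :=
  tag x.

Definition dcol (k : nat) (d : 'I_k -> seq segment) (x : dindex d) : nat :=
  tagged x.

Definition dpiece (k : nat) (d : 'I_k -> seq segment) (x : dindex d) : segment :=
  tnth (in_tuple (d (tag x))) (tagged x).

Definition dlex (k : nat) (d : 'I_k -> seq segment) (x y : dindex d) : bool :=
  (drow x < drow y)%N || (drow x == drow y) && (dcol x < dcol y)%N.

Definition dll (k : nat) (d : 'I_k -> seq segment) (x y : dindex d) : bool :=
  (drow x < drow y)%N.

Definition relevant (k : nat) (d : 'I_k -> seq segment) : Prop :=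
  exists tau : dindex d -> dindex d,
    [/\ involutive tau,
        forall x y : dindex d, drow y = drow x -> dcol y = (dcol x).+1 ->
          dll (tau y) (tau x),
        forall x : dindex d, tau x <> x
      & forall x : dindex d, dlex x (tau x) ->
          dpiece x = seg_shift (dpiece (tau x))].

Definition distinguished (m : multisegment) : Prop :=
  forall s : seq segment, is_order m s -> standard s ->
    exists2 d : 'I_(size s) -> seq segment, order_decomp d & relevant d.

Definition speh_type (m : multisegment) : Prop :=
  exists n : multisegment, m = n `+` mseg_shift n.

(* Main.v *)
Require Import Defs.
From mathcomp Require Import all_boot all_order all_algebra.
From mathcomp Require Import finmap multiset.
From mathcomp Require Import zify.

(** Only one standard order of the multisegment is needed: the one sorted by
    decreasing beginning and, among equal beginnings, by increasing end.  Part
    (2) is then a weakening of part (1).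

    A relevant decomposition is best seen point by point.  For a point p of
    row i let g i p be the row of the partner of the piece of row i containing
    p.  By (R1) the function g i is nondecreasing in p and takes distinct
    values on distinct pieces, so the pieces are exactly its level sets and
    nothing is lost by forgetting them.  By (R3), if g i p = j > i then p - 1
    is a point of row j with g j (p - 1) = i, and symmetrically with p + 1 when
    j < i.  This structure is called a matching below; it is produced from a
    relevant decomposition by matching_of_relevant, and it stays meaningful on
    a subset of the rows, which makes induction on the set of rows possible.

    Let r be the first row and x its beginning, the largest of all.  A row
    having a point matched with r must, by monotonicity, begin with such a
    point, hence begin at x - 1 or above; this forces the whole row r to be
    matched with a single row i, and i begins at x - 1 (first_row_partner).  The same idea
    shows that a row v beginning below y that is matched with an earlier row
    beginning at y or above already occupies the bottom point y of a row
    beginning at y (descent); since there are at most two such rows and the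
    bottom points at x - 1 are largely taken by the rows beginning at x, little
    freedom is left.

    If a second row t begins at x, then the two rows i and j beginning at x - 1
    have their bottom points matched with r and t, so by descent the four rows
    r, t, i, j are matched among themselves; comparing the ends shows that, in
    one order or the other, the segments of i and j are the shifts by -1 of
    those of r and t (peel_pair).  If r is alone at x, then either i is the
    shift of r by -1, or the other row k beginning at x - 1 is; in the latter case
    two pairs of rows are matched crosswise and can be uncrossed so that r is
    matched with k (uncross, peel_single).  In all cases one or two pairs of
    the form (nu D, D) can be removed while the rest keeps a matching, and
    induction gives the Speh form. *)

Set Implicit Arguments.
Unset Strict Implicit.
Unset Printing Implicit Defensive.
Import Order.TTheory GRing.Theory Num.Theory.
Local Open Scope ring_scope.

Implicit Types (D : nat -> segment) (l R : seq nat) (g : nat -> int -> nat).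

Local Notation within A p := (sbeg A <= p <= send A).

(** * Matchings of rows *)

(** Only the values of g at points of the rows listed in l are constrained, so
    rows can be removed without renumbering the others. *)
Record matching D l g : Prop := Matching {
  match_mem : forall i p, i \in l -> within (D i) p -> g i p \in l;
  match_mono : forall i p q, i \in l -> within (D i) p -> within (D i) q ->
    p <= q -> (g i p <= g i q)%N;
  match_step : forall i p, i \in l -> within (D i) p ->
    [/\ (i < g i p)%N, within (D (g i p)) (p - 1) & g (g i p) (p - 1) = i] \/
    [/\ (g i p < i)%N, within (D (g i p)) (p + 1) & g (g i p) (p + 1) = i]
}.

(** In the presence of sortedness, layout_thin says that at most two rows share
    a beginning; this form passes to subsets of the rows at once. *)
Record layout D l : Prop := Layout {
  layout_sorted : forall i j, i \in l -> j \in l -> (i < j)%N ->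
    sbeg (D j) < sbeg (D i) \/
    sbeg (D j) = sbeg (D i) /\ send (D i) <= send (D j);
  layout_thin : forall i j k, i \in l -> j \in l -> k \in l ->
    (i < j)%N -> (j < k)%N -> sbeg (D k) < sbeg (D i)
}.

Lemma layout_beg D l i j : layout D l -> i \in l -> j \in l -> (i <= j)%N ->
  sbeg (D j) <= sbeg (D i).
Proof.
move=> L li lj; rewrite leq_eqVlt => /predU1P[->//|ij].
by have := layout_sorted L li lj ij; lia.
Qed.

Lemma within_beg A : within A (sbeg A).
Proof. by rewrite lexx seg_le. Qed.

Lemma within_end A : within A (send A).
Proof. by rewrite lexx seg_le. Qed.

Lemma match_down D l g a b p : matching D l g ->
  a \in l -> within (D a) p -> g a p = b -> (a < b)%N ->
  within (D b) (p - 1) /\ g b (p - 1) = a.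
Proof.
by move=> M la ap <- ab; have [[]|[]] := match_step M la ap => //; lia.
Qed.

Lemma match_up D l g a b p : matching D l g ->
  a \in l -> within (D a) p -> g a p = b -> (b < a)%N ->
  within (D b) (p + 1) /\ g b (p + 1) = a.
Proof.
by move=> M la ap <- ab; have [[]|[]] := match_step M la ap => //; lia.
Qed.

Lemma match_neq D l g a p : matching D l g -> a \in l -> within (D a) p ->
  g a p != a.
Proof. by move=> M la ap; have [[]|[]] := match_step M la ap; lia. Qed.

Lemma thin_two D l i j k : layout D l -> i \in l -> j \in l -> i != j ->
  sbeg (D i) = sbeg (D j) -> k \in l -> sbeg (D k) = sbeg (D i) ->
  k = i \/ k = j.
Proof.
move=> L li lj ij bij lk bk.
have h a b c : a \in l -> b \in l -> c \in l -> sbeg (D a) = sbeg (D c) ->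
    ~ (a < b < c)%N.
  by move=> la lb lc e /andP[ab bc]; have := layout_thin L la lb lc ab bc; lia.
have := h k i j lk li lj; have := h i k j li lk lj; have := h i j k li lj lk.
have := h j i k lj li lk; have := h j k i lj lk li; have := h k j i lk lj li.
by lia.
Qed.

(** Let v be the row g w q, which is later than w.  By monotonicity the bottom
    point b of v is matched with a row u no later than w, so u begins at y or
    above; as u contains b + 1, which is at most y, it begins exactly at y. *)
Lemma descent D l g y w q : layout D l -> matching D l g ->
  w \in l -> within (D w) q -> y <= sbeg (D w) -> sbeg (D (g w q)) < y ->
  exists u, [/\ u \in l, (u <= w)%N, sbeg (D u) = y,
    sbeg (D (g w q)) = y - 1 & g u y = g w q].
Proof.
move=> L M lw wq yw vy.
have lv := match_mem M lw wq.
have [[wv vq gvq]|[vw _ _]] := match_step M lw wq; last first.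
  by have := layout_beg L lv lw (ltnW vw); lia.
set v := g w q in vy lv wv vq gvq *.
have wb := within_beg (D v).
have uw : (g v (sbeg (D v)) <= w)%N.
  by rewrite -gvq; apply: (match_mono M) => //; lia.
have lu := match_mem M lv wb.
have := layout_beg L lu lw uw.
have [[]|[uv ub gub]] := match_step M lv wb; first by lia.
move=> wu; exists (g v (sbeg (D v))).
have e : sbeg (D v) + 1 = y by lia.
by split=> //; [lia|lia|rewrite -e].
Qed.

(** A row having a point matched with the first row r has its bottom point
    matched with r too, hence begins no lower than one below r.  It also comes
    no earlier than the partner of the bottom point of r, hence begins no
    higher.  So its own bottom point is matched with the bottom point of r,
    which singles it out. *)
Lemma first_row_partner D l g r : layout D l -> matching D l g ->
  r \in l -> (forall k, k \in l -> (r <= k)%N) ->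
  exists i, [/\ i \in l, (r < i)%N, sbeg (D i) = sbeg (D r) - 1 &
    forall p, within (D r) p -> g r p = i].
Proof.
move=> L M lr rmin.
have key p : within (D r) p -> [/\ g r p \in l, (r < g r p)%N,
    sbeg (D (g r p)) = sbeg (D r) - 1 & g r (sbeg (D r)) = g r p].
  move=> rp; have lv := match_mem M lr rp.
  have [[rv vp gvp]|[]] := match_step M lr rp; last by have := rmin _ lv; lia.
  set v := g r p in lv rv vp gvp *.
  have wb := within_beg (D v).
  have ur : g v (sbeg (D v)) = r.
    apply/eqP; rewrite eqn_leq (rmin _ (match_mem M lv wb)) andbT -gvp.
    by apply: (match_mono M) => //; lia.
  have [[]|[_]] := match_step M lv wb; first by rewrite ur; lia.
  rewrite ur => rb gr.
  have wr := within_beg (D r).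
  have [[ri ip _]|[]] := match_step M lr wr; last first.
    by have := rmin _ (match_mem M lr wr); lia.
  have iv : (g r (sbeg (D r)) <= v)%N by apply: (match_mono M) => //; lia.
  have bv := layout_beg L (match_mem M lr wr) lv iv.
  have e : sbeg (D v) + 1 = sbeg (D r) by lia.
  by split=> //; [lia|rewrite -e].
have [li ri bi _] := key _ (within_beg (D r)).
by exists (g r (sbeg (D r))); split=> // p /key[].
Qed.

Lemma first_row_only D l g r i : matching D l g -> r \in l ->
  (forall k, k \in l -> (r <= k)%N) ->
  (forall p, within (D r) p -> g r p = i) ->
  forall k p, k \in l -> within (D k) p -> g k p = r ->
    within (D r) (p + 1) /\ k = i.
Proof.
move=> M lr rmin gr k p lk kp e.
have rk : (r < k)%N.
  by have := rmin _ lk; have := match_neq M lk kp; rewrite e; lia.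
have [rp gp] := match_up M lk kp e rk.
by split=> //; rewrite -gp gr.
Qed.

Definition closed_rows D g R :=
  forall k p, k \in R -> within (D k) p -> g k p \in R.

Lemma matching_off D l g R : matching D l g -> {subset R <= l} ->
  closed_rows D g R -> matching D [seq k <- l | k \notin R] g.
Proof.
move=> M sR cR; split=> [k p|k p q|k p]; rewrite mem_filter => /andP[kR lk].
- move=> kp; rewrite mem_filter (match_mem M lk kp) andbT.
  apply: contra kR => jR.
  by case: (match_step M lk kp) => -[_ jp <-]; apply: cR.
- exact: (match_mono M).
- exact: (match_step M).
Qed.

Lemma layout_sub D l l' : layout D l -> {subset l' <= l} -> layout D l'.
Proof.
move=> L s; split=> [i j /s li /s lj|i j k /s li /s lj /s lk].
  exact: (layout_sorted L).
exact: (layout_thin L).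
Qed.

Lemma seg_shift_eq (A B : segment) :
  sbeg B = sbeg A - 1 -> send B = send A - 1 -> A = seg_shift B.
Proof.
move=> hb he; apply: val_inj => /=; rewrite hb he !subrK.
by rewrite /sbeg /send; case: (seg_ends A).
Qed.

Lemma perm_off l R : uniq l -> uniq R -> {subset R <= l} ->
  perm_eq l (R ++ [seq k <- l | k \notin R]).
Proof.
move=> ul uR sR; apply: uniq_perm => // [|k].
  rewrite cat_uniq uR filter_uniq // andbT /=.
  by apply/hasPn => k; rewrite mem_filter => /andP[].
by rewrite mem_cat mem_filter; case: (boolP (k \in R)) => //= /sR ->.
Qed.

(** * Peeling off the rows with the largest beginning *)

(** The rows i and j beginning one below r and t use up their bottom points on
    r and t, so no lower row can reach any of the four. *)
Lemma top_pair_closed D l g r t : layout D l -> matching D l g ->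
  r \in l -> (forall k, k \in l -> (r <= k)%N) ->
  t \in l -> t != r -> sbeg (D t) = sbeg (D r) ->
  exists i j, [/\ uniq [:: r; i; t; j], {subset [:: r; i; t; j] <= l},
    sbeg (D i) = sbeg (D r) - 1 /\ sbeg (D j) = sbeg (D r) - 1,
    (forall p, within (D r) p -> g r p = i) /\ g t (sbeg (D t)) = j &
    closed_rows D g [:: r; i; t; j]].
Proof.
move=> L M lr rmin lt tr bt.
have [i [li ri bi gr]] := first_row_partner L M lr rmin.
have toR := first_row_only M lr rmin gr.
have [x ex] : exists x, sbeg (D r) = x by exists (sbeg (D r)).
rewrite ex in bt bi.
have wr : within (D r) x by rewrite -ex within_beg.
have wt : within (D t) x by rewrite -bt within_beg.
have rt : (r < t)%N by have := rmin _ lt; lia.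
have top k : k \in l -> sbeg (D k) <= x.
  by move=> lk; rewrite -ex; exact: (layout_beg L lr lk (rmin _ lk)).
have twox k : k \in l -> sbeg (D k) = x -> k = r \/ k = t.
  by move=> lk bk; apply: thin_two L _ _ _ _ lk _; rewrite ?ex // eq_sym.
have ti : (t < i)%N.
  case: (ltngtP t i) => // [it|e]; last by move: bi; rewrite -e; lia.
  by have := layout_beg L li lt (ltnW it); lia.
have [_ gix] := match_down M lr wr (gr _ wr) ri.
move ej: (g t x) => j.
have lj : j \in l by rewrite -ej (match_mem M lt wt).
have tj : (t < j)%N.
  have := match_neq M lt wt; rewrite ej; case: (ltngtP t j) => // jt _.
  have jx : sbeg (D j) = x.
    by have := layout_beg L lj lt (ltnW jt); have := top _ lj; lia.
  have [e|e] := twox _ lj jx; last by lia.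
  by have [_] := toR _ _ lt wt (etrans ej e); lia.
have [jx gjx] := match_down M lt wt ej tj.
have bj : sbeg (D j) = x - 1.
  have wj := within_beg (D j); have lu := match_mem M lj wj.
  move eu : (g j (sbeg (D j))) lu => u lu.
  have ut : (u <= t)%N by rewrite -gjx -eu; apply: (match_mono M) => //; lia.
  have bu := layout_beg L lu lt ut.
  by have [] := match_up M lj wj eu ltac:(lia); lia.
have ij : i != j by apply/eqP => e; move: gjx; rewrite -e gix; lia.
rewrite -bt in ej.
have twoy k : k \in l -> sbeg (D k) = x - 1 -> k = i \/ k = j.
  by move=> lk bk; apply: thin_two L _ _ _ _ lk _; rewrite ?bi.
exists i, j; split=> //; rewrite ?bi ?bj ?ex //.
- by rewrite /= !inE; lia.
- by move=> k; rewrite !inE => /or4P[]/eqP->.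
move=> k p kR kp.
have lk : k \in l by move: kR; rewrite !inE => /or4P[]/eqP->.
have bk : x - 1 <= sbeg (D k) by move: kR; rewrite !inE => /or4P[]/eqP->; lia.
have lv := match_mem M lk kp.
have [bv|bv] := leP (x - 1) (sbeg (D (g k p))); last first.
  have [u [lu _ bu bv' e]] := descent L M lk kp bk bv.
  by have [eu|eu] := twoy u lu bu; move: e bv'; rewrite eu ?gix ?gjx => <-; lia.
have bv' := top _ lv; rewrite !inE.
have [/(twox _ lv)|/(twoy _ lv)] :
  sbeg (D (g k p)) = x \/ sbeg (D (g k p)) = x - 1 by lia.
all: by case=> ->; rewrite eqxx ?orbT.
Qed.

(** The four rows being matched among themselves, a top point of one of them is
    matched with a point one above or below in another; comparing the four top
    points leaves only two possibilities. *)
Lemma top_pair_ends D l g r t i j : layout D l -> matching D l g ->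
  (forall k, k \in l -> (r <= k)%N) -> sbeg (D t) = sbeg (D r) ->
  uniq [:: r; i; t; j] -> {subset [:: r; i; t; j] <= l} ->
  sbeg (D i) = sbeg (D r) - 1 -> sbeg (D j) = sbeg (D r) - 1 ->
  (forall p, within (D r) p -> g r p = i) -> g t (sbeg (D t)) = j ->
  closed_rows D g [:: r; i; t; j] ->
  send (D i) = send (D r) - 1 /\ send (D j) = send (D t) - 1 \/
  send (D j) = send (D r) - 1 /\ send (D i) = send (D t) - 1.
Proof.
move=> L M rmin bt un sub bi bj gr gtx clos.
have [lr li lt lj] : [/\ r \in l, i \in l, t \in l & j \in l].
  by split; apply: sub; rewrite !inE eqxx ?orbT.
have toR := first_row_only M lr rmin gr.
have wt := within_beg (D t).
have er := within_end (D r); have et := within_end (D t).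
have ei := within_end (D i); have ej := within_end (D j).
have down a b p := @match_down D l g a b p M.
have up a b p := @match_up D l g a b p M.
have lt_beg a b : a \in l -> b \in l -> sbeg (D b) < sbeg (D a) -> (a < b)%N.
  by move=> la lb h; rewrite ltnNge; apply/negP => /(layout_beg L lb la); lia.
have ti : (t < i)%N by apply: lt_beg => //; lia.
have tj : (t < j)%N by apply: lt_beg => //; lia.
have ri : (r < i)%N by apply: lt_beg => //; lia.
have rt : (r < t)%N.
  by have := rmin _ lt; move: un; rewrite /= !inE; lia.
have ij : i != j by move: un; rewrite /= !inE; lia.
clear lt_beg.
have gt p : within (D t) p -> g t p = i \/ g t p = j.
  move=> tp; have := clos t p; rewrite !inE eqxx !orbT => /(_ isT tp).
  case/or4P=> /eqP; [|by left| |by right].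
    by move/(toR _ _ lt tp) => []; lia.
  by have := match_neq M lt tp; lia.
have gI p : within (D i) p -> [\/ g i p = r, g i p = t | g i p = j].
  move=> tp; have := clos i p; rewrite !inE eqxx !orbT => /(_ isT tp).
  case/or4P=> /eqP; [by constructor 1| |by constructor 2|by constructor 3].
  by have := match_neq M li tp; lia.
have gJ p : within (D j) p -> g j p = t \/ g j p = i.
  move=> tp; have := clos j p; rewrite !inE eqxx !orbT => /(_ isT tp).
  case/or4P=> /eqP; [|by right|by left|].
    by move/(toR _ _ lj tp) => []; lia.
  by have := match_neq M lj tp; lia.
have rt_le : send (D r) <= send (D t).
  by have := layout_sorted L lr lt rt; lia.
have [er1 er2] := down _ _ _ lr er (gr _ er) ri.
clear clos un sub rmin.
have [ij'|ji'] : (i < j)%N \/ (j < i)%N by lia.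
- left.
  have gtj p : within (D t) p -> g t p = j.
    move=> tp; have [e|//] := gt _ tp.
    by have := match_mono M lt wt tp; rewrite gtx e; lia.
  have hi : send (D i) = send (D r) - 1.
    have [//|lti] : send (D i) = send (D r) - 1 \/ send (D r) <= send (D i) by lia.
    have ri' : within (D i) (send (D r)) by lia.
    have tr' : within (D t) (send (D r)) by lia.
    have [e|e|e] := gI _ ri'.
    + by have [] := toR _ _ li ri' e; lia.
    + by have [u1 u2] := up _ _ _ li ri' e ti; have := gtj _ u1; lia.
    + have [_] := down _ _ _ li ri' e ij'.
      by have [_ ->] := down _ _ _ lt tr' (gtj _ tr') tj; lia.
  split=> //.
  have [te _] := down _ _ _ lt et (gtj _ et) tj.
  have [//|ltj] : send (D j) = send (D t) - 1 \/ send (D t) <= send (D j) by lia.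
  have tj' : within (D j) (send (D t)) by lia.
  have [e|e] := gJ _ tj'.
  + by have [] := up _ _ _ lj tj' e tj; lia.
  + by have [] := up _ _ _ lj tj' e ij'; lia.
- (* Row i ends last, so its top point cannot be matched upwards with j; by
     monotonicity rows i and j are not matched with each other at all. *)
  have ji_le : send (D j) <= send (D i).
    by have := layout_sorted L lj li ji'; lia.
  have gir p : within (D i) p -> g i p = r \/ g i p = t.
    have [e|e|e] := gI _ ei.
    + by move=> ip; have := match_mono M li ip ei; have [] := gI _ ip; lia.
    + by move=> ip; have := match_mono M li ip ei; have [] := gI _ ip; lia.
    + by have [] := up _ _ _ li ei e ji'; lia.
  have gjt p : within (D j) p -> g j p = t.
    move=> jp; have [//|e] := gJ _ jp.
    have [ip e'] := down _ _ _ lj jp e ji'.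
    by have := gir _ ip; lia.
  have [ejt _] := up _ _ _ lj ej (gjt _ ej) tj.
  have [e|e] := gt _ et.
  + right.
    have [it git] := down _ _ _ lt et e ti.
    have e1 : send (D i) = send (D t) - 1.
      have [//|lti] : send (D i) = send (D t) - 1 \/ send (D t) <= send (D i) by lia.
      by have [f|f] := gir _ ei;
        [have [] := toR _ _ li ei f|have [] := up _ _ _ li ei f ti]; lia.
    split=> //.
    have tr' : within (D t) (send (D r)) by lia.
    have [f|f] := gt _ tr'.
      by have [_] := down _ _ _ lt tr' f ti; lia.
    have [jr _] := down _ _ _ lt tr' f tj.
    have [//|ltj] : send (D j) = send (D r) - 1 \/ send (D r) <= send (D j) by lia.
    have jr' : within (D j) (send (D r)) by lia.
    have [t1 gt1] := up _ _ _ lj jr' (gjt _ jr') tj.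
    have ir' : within (D i) (send (D r)) by lia.
    have [h|h] := gir _ ir'.
      by have [] := toR _ _ li ir' h; lia.
    by have [_] := up _ _ _ li ir' h ti; lia.
  + left.
    have [jt _] := down _ _ _ lt et e tj.
    split; last by lia.
    have [f|f] := gir _ ei; first by have [] := toR _ _ li ei f; lia.
    have [t1 g1] := up _ _ _ li ei f ti.
    by have := match_mono M lt t1 et; lia.
Qed.

Lemma peel_pair D l g r t : layout D l -> matching D l g ->
  r \in l -> (forall k, k \in l -> (r <= k)%N) ->
  t \in l -> t != r -> sbeg (D t) = sbeg (D r) ->
  exists i j, [/\ uniq [:: r; i; t; j], {subset [:: r; i; t; j] <= l},
    D r = seg_shift (D i), D t = seg_shift (D j) &
    closed_rows D g [:: r; i; t; j]].
Proof.
move=> L M lr rmin lt tr bt.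
have [i [j [un sub [bi bj] [gr gtx] clos]]] :=
  top_pair_closed L M lr rmin lt tr bt.
have [[h1 h2]|[h1 h2]] :=
  top_pair_ends L M rmin bt un sub bi bj gr gtx clos.
- by exists i, j; split=> //; apply: seg_shift_eq; lia.
- exists j, i; split=> //; try (apply: seg_shift_eq; lia).
  + by move: un; rewrite /= !inE; lia.
  + by move=> k kR; apply: sub; move: kR; rewrite !inE; lia.
  + move=> k p kR kp; have := clos k p; rewrite !inE in kR *; move=> /(_ _ kp).
    lia.
Qed.

(** Initially r is matched with the lower part of i, whose next point goes down
    to j, while the lower part of j is matched with the whole of k.  As the
    segment of k is the shift by -1 of that of r, the blocks can be exchanged: the
    lower part of i goes to the lower part of j, which frees r and k for each
    other.  Monotonicity survives because the new partners continue the
    matching of i and j that exists above. *)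
Lemma uncross D l g r i k j (c := send (D r)) : matching D l g ->
  r \in l -> (forall a, a \in l -> (r <= a)%N) -> i \in l -> k \in l ->
  j \in l -> (k < i < j)%N -> r != k -> r != i ->
  sbeg (D i) = sbeg (D k) -> sbeg (D j) = sbeg (D k) - 1 ->
  send (D k) = c - 1 -> within (D i) c -> g i c = j ->
  (forall p, within (D r) p -> g r p = i) ->
  (forall p, within (D k) p -> g k p = j) ->
  exists g', matching D [seq a <- l | a \notin [:: r; k]] g'.
Proof.
move=> M lr rmin li lk lj /andP[ki ij] kr nri bi bj ek ic' ej gr gk.
have toR := first_row_only M lr rmin gr.
have ri : (r < i)%N by have := rmin _ li; lia.
have kj : (k < j)%N by lia.
have er : within (D r) c := within_end (D r).
have ecr : send (D r) = c by [].
clearbody c.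
have [ic gic] := match_down M lr er (gr _ er) ri.
have [jc gjc] := match_down M li ic' ej ij.
have irE p : within (D i) p -> (g i p == r) = (p <= c - 1).
  move=> ip; apply/eqP/idP => [e|pc].
    by have [] := toR _ _ li ip e; lia.
  have := match_mono M li ip ic pc; rewrite gic.
  by have := rmin _ (match_mem M li ip); lia.
have jkE p : within (D j) p -> (g j p == k) = (p <= c - 2).
  move=> jp; apply/eqP/idP => [e|pc].
    by have [] := match_up M lj jp e kj; lia.
  have kp : within (D k) (p + 1) by lia.
  by have [_] := match_down M lk kp (gk _ kp) kj; rewrite addrK.
(* By irE and jkE, the two altered ranges are the lower part of i, formerly
   matched with r, and the lower part of j, formerly matched with k. *)
pose g' a p :=
  if (a == i) && (p <= c - 1) then j
  else if (a == j) && (p <= c - 2) then i else g a p.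
exists g'.
have g'i p : p <= c - 1 -> g' i p = j by rewrite /g' eqxx => ->.
have g'j p : p <= c - 2 -> g' j p = i.
  by rewrite /g' eqxx => ->; have -> : (j == i) = false by lia.
have toK a p : a \in l -> within (D a) p -> g a p = k -> a = j.
  by move=> la ap e; have [[_]|[_]] := match_step M la ap; rewrite e => /gk ->.
have other a p : a \in l -> within (D a) p -> g a p != r -> g a p != k ->
    g' a p = g a p.
  move=> la ap; rewrite /g'.
  case: (eqVneq a i) => [ai|_] /=.
    by move: ap; rewrite ai => /irE <- /negPf ->; have -> : (i == j) = false by lia.
  by case: (eqVneq a j) => [aj|//]; move: ap; rewrite aj => /jkE <- _ /negPf ->.
have cases a p : a \in l -> a != r -> a != k -> within (D a) p ->
    [\/ a = i /\ p <= c - 1, a = j /\ p <= c - 2 |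
      [/\ g a p != r, g a p != k & g' a p = g a p]].
  move=> la ar ak ap.
  case: (eqVneq (g a p) r) => [e|nr].
    by have [_ ai] := toR _ _ la ap e; constructor 1; move: e ap; rewrite ai =>
      /eqP + ip; rewrite irE.
  case: (eqVneq (g a p) k) => [e|nk].
    by have aj := toK _ _ la ap e; constructor 2; move: e ap; rewrite aj =>
      /eqP + jp; rewrite jkE.
  by constructor 3; split=> //; exact: other.
have inl a : (a \in [seq a <- l | a \notin [:: r; k]]) =
    [&& a \in l, a != r & a != k].
  by rewrite mem_filter !inE negb_or andbC.
split=> [a p|a p q|a p]; rewrite inl => /and3P[la ar ak] ap.
- rewrite inl; have [[-> h]|[-> h]|[nr nk ->]] := cases _ _ la ar ak ap.
  + by rewrite g'i // lj; lia.
  + by rewrite g'j // li; lia.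
  + by rewrite (match_mem M la ap) nr.
- move=> aq pq.
  have [[ai h]|[aj h]|[nr nk ->]] := cases _ _ la ar ak ap.
  + rewrite ai in aq *; rewrite g'i //.
    have [[_ h']|[e _]|[nr _ ->]] := cases _ _ li ltac:(lia) ltac:(lia) aq.
    * by rewrite g'i.
    * by lia.
    * rewrite irE // in nr.
      by have := match_mono M li ic' aq ltac:(lia); rewrite ej.
  + rewrite aj in aq *; rewrite g'j //.
    have [[e _]|[_ h']|[_ nk ->]] := cases _ _ lj ltac:(lia) ltac:(lia) aq.
    * by lia.
    * by rewrite g'j.
    * rewrite jkE // in nk.
      by have := match_mono M lj jc aq ltac:(lia); rewrite gjc.
  + have := match_mono M la ap aq pq.
    have [[ai h]|[aj h]|[_ _ ->//]] := cases _ _ la ar ak aq.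
      by move: nr ap; rewrite ai => + ip; rewrite irE //; lia.
    by move: nk ap; rewrite aj => + ip; rewrite jkE //; lia.
- have [[ai h]|[aj h]|[nr nk ->]] := cases _ _ la ar ak ap.
  + left; rewrite ai in ap *; rewrite g'i // g'j; last by lia.
    by split=> //; lia.
  + right; rewrite aj in ap *; rewrite g'j // g'i; last by lia.
    by split=> //; lia.
  + have lv := match_mem M la ap.
    by have [[h1 h2 h3]|[h1 h2 h3]] := match_step M la ap; [left|right];
      rewrite other ?h3.
Qed.

(** The alternatives are decided at the point c where r ends: if i also covers
    c, that point must be matched with a row j beginning two below r, and this
    requires a second row k beginning one below r, which then is exactly the
    shift of r by -1. *)
Lemma peel_single D l g r : layout D l -> matching D l g ->
  r \in l -> (forall k, k \in l -> (r <= k)%N) ->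
  (forall k, k \in l -> sbeg (D k) = sbeg (D r) -> k = r) ->
  exists i g', [/\ i \in l, i != r, D r = seg_shift (D i) &
    matching D [seq k <- l | k \notin [:: r; i]] g'].
Proof.
move=> L M lr rmin rtop.
have [i [li ri bi gr]] := first_row_partner L M lr rmin.
have toR := first_row_only M lr rmin gr.
have ei := within_end (D i).
move ex: (sbeg (D r)) => x in bi; move ec : (send (D r)) => c.
have xc : x <= c by rewrite -ex -ec seg_le.
have wr : within (D r) x by lia.
have er : within (D r) c by lia.
have top k : k \in l -> k != r -> sbeg (D k) < x.
  move=> lk kr; have := layout_beg L lr lk (rmin _ lk).
  by have [/(rtop _ lk)|] := eqVneq (sbeg (D k)) (sbeg (D r)); lia.
have [ix gix] := match_down M lr wr (gr _ wr) ri.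
have [ic gic] := match_down M lr er (gr _ er) ri.
have desc w q : w \in l -> within (D w) q -> x - 1 <= sbeg (D w) ->
    sbeg (D (g w q)) < x - 1 -> exists k, [/\ k \in l, k != i, (k <= w)%N,
    sbeg (D k) = x - 1 & sbeg (D (g w q)) = x - 2 /\ g k (x - 1) = g w q].
  move=> lw wq bw bv; have [k [lk kw bk bv' e]] := descent L M lw wq bw bv.
  exists k; split=> //; last by split=> //; lia.
  by apply/eqP=> ki; move: bv' e; rewrite ki gix => + er'; rewrite -er'; lia.
have y_of k : k \in l -> k != r -> x - 1 <= sbeg (D k) -> sbeg (D k) = x - 1.
  by move=> lk kr; have := top _ lk kr; lia.
have [eic|ltc] : send (D i) = c - 1 \/ c <= send (D i) by lia.
  exists i, g; split=> //; [by lia|by apply: seg_shift_eq; lia|].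
  apply: matching_off => //.
    by move=> k; rewrite !inE => /pred2P[]->.
  move=> k p; rewrite !inE => /pred2P[->|->] kp; first by rewrite gr ?eqxx ?orbT.
  have rp : within (D r) (p + 1) by lia.
  by have [_] := match_down M lr rp (gr _ rp) ri; rewrite addrK => ->; rewrite eqxx.
have ic' : within (D i) c by lia.
move ej : (g i c) => j.
have lj : j \in l by rewrite -ej; exact: (match_mem M li ic').
(* If j preceded i, both would begin at x - 1, and no row would be left to
   match the bottom point of j. *)
have ij : (i < j)%N.
  have := match_neq M li ic'; rewrite ej => jni.
  case: (ltngtP i j) jni => // ji _.
  have jr : j != r.
    by apply/eqP => jr; have [] := toR _ _ li ic' (etrans ej jr); lia.
  have bj := y_of j lj jr; have := layout_beg L lj li (ltnW ji) => bji.
  have {}bj := bj ltac:(lia).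
  have [jc gjc] := match_up M li ic' ej ji.
  have jx : within (D j) (x - 1) by lia.
  have lu := match_mem M lj jx; have := match_neq M lj jx.
  have := match_mono M lj jx jc ltac:(lia); rewrite gjc.
  move eu : (g j (x - 1)) lu => u lu ui uj.
  have ur : u != r by apply/eqP => ur; have [] := toR _ _ lj jx (etrans eu ur); lia.
  have [ui'|ui'] : u = i \/ (u < i)%N by lia.
    by have [] := match_down M lj jx (etrans eu ui') ji; lia.
  have bu := y_of u lu ur; have := layout_beg L lu li (ltnW ui') => bui.
  have {}bu := bu ltac:(lia).
  by have [] := thin_two L li lj _ _ lu; lia.
have [jc gjc] := match_down M li ic' ej ij.
have bji := layout_beg L li lj (ltnW ij).
(* If j began at x - 1 too, it would end no earlier than i, so its top point
   would be matched with a row below; by descent that row would occupy the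
   bottom point of j, which is taken by i. *)
have [bj|bj] : sbeg (D j) = x - 1 \/ sbeg (D j) < x - 1 by lia.
  have eij : send (D i) <= send (D j).
    by have := layout_sorted L li lj ij; lia.
  have two := thin_two L li lj ltac:(lia) ltac:(lia).
  have jx : within (D j) (x - 1) by lia.
  have gjx : g j (x - 1) = i.
    have lu := match_mem M lj jx; have := match_neq M lj jx.
    have := match_mono M lj jx jc ltac:(lia); rewrite gjc.
    move eu : (g j (x - 1)) lu => u lu ui uj.
    have ur : u != r by apply/eqP => ur; have [] := toR _ _ lj jx (etrans eu ur); lia.
    have bu := layout_beg L lu li ui.
    by have := two u lu; have := y_of u lu ur; lia.
  have je := within_end (D j).
  have lh := match_mem M lj je; have hj := match_neq M lj je.
  have := match_mono M lj jc je ltac:(lia); rewrite gjc => ih.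
  have [hi|hi] : g j (send (D j)) = i \/ (i < g j (send (D j)))%N by lia.
    by have [] := match_up M lj je hi ij; lia.
  have bh := layout_beg L li lh (ltnW hi).
  have [bh'|bh'] : sbeg (D (g j (send (D j)))) = x - 1 \/
      sbeg (D (g j (send (D j)))) < x - 1 by lia.
    by have := two _ lh; lia.
  have [k [lk ki _ bk [_]]] := desc _ _ lj je ltac:(lia) bh'.
  by have [e|->] := two k lk ltac:(lia); [lia|rewrite gjx; lia].
have := desc i c li ic' ltac:(lia); rewrite ej => /(_ bj).
case=> k [lk ki0 kle bk [{}bj gkx]].
have ki : (k < i)%N by lia.
have kr : r != k by apply/eqP => e; move: bk; rewrite -e; lia.
have two := thin_two L li lk ltac:(lia) ltac:(lia).
have kx : within (D k) (x - 1) by have := seg_le (D k); lia.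
have gk p : within (D k) p -> g k p = j.
  move=> kp; have := match_mono M lk kx kp ltac:(lia); rewrite gkx => jv.
  have lv := match_mem M lk kp; have kv := match_neq M lk kp.
  have bv := layout_beg L lk lv ltac:(lia).
  have [bv'|bv'] : sbeg (D (g k p)) = x - 1 \/ sbeg (D (g k p)) < x - 1 by lia.
    by have := two _ lv; lia.
  have [k' [lk' ki' _ bk' [_]]] := desc _ _ lk kp ltac:(lia) bv'.
  have [e|e] := two k' lk' ltac:(lia); first by lia.
  by rewrite e gkx => ->.
have ke := within_end (D k).
have kj : (k < j)%N by lia.
(* The point c - 1 of j is matched with i; if k went beyond c - 1, a point of j
   at or above c - 1 would be matched with k, which precedes i; if k stopped short of it,
   the point c - 2 of j could be matched with no row. *)
have ek : send (D k) = c - 1.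
  have [je gje] := match_down M lk ke (gk _ ke) kj.
  have [e|[|e]] : send (D k) = c - 1 \/ c <= send (D k) \/ send (D k) < c - 1
    by lia.
  - by [].
  - by move=> e; have := match_mono M lj jc je ltac:(lia); rewrite gjc gje; lia.
  have jc2 : within (D j) (c - 2) by have := seg_le (D k); lia.
  have lu := match_mem M lj jc2.
  have := match_mono M lj jc2 jc ltac:(lia); rewrite gjc.
  move eu : (g j (c - 2)) lu => u lu ui.
  have cc : c - 2 + 1 = c - 1 by lia.
  have [eui|ui'] : u = i \/ (u < i)%N by lia.
    by have [_] := match_up M lj jc2 (etrans eu eui) ij; rewrite cc gic; lia.
  have [uc _] := match_up M lj jc2 eu ltac:(lia).
  have ur : u != r by apply/eqP => ur; have [] := toR _ _ lj jc2 (etrans eu ur); lia.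
  have bu := layout_beg L lu li ui; have bu' := y_of u lu ur ltac:(lia).
  by have [euk|euk] := two u lu ltac:(lia); move: uc; rewrite euk; lia.
exists k.
have [g' M'] : exists g', matching D [seq a <- l | a \notin [:: r; k]] g'.
  apply: (@uncross D l g r i k j) => //; rewrite ?ec //; lia.
by exists g'; split=> //; [lia|apply: seg_shift_eq; lia].
Qed.

(** * Induction on the set of rows *)

Lemma matching_speh D l g : layout D l -> matching D l g -> uniq l ->
  exists n : seq segment, perm_eq [seq D i | i <- l] (n ++ map seg_shift n).
Proof.
have [m] := ubnP (size l); elim: m => // m IH in l g *.
move=> szl L M ul; have [l0|[k0 lk0]] : l = [::] \/ exists k, k \in l.
- by case: l {szl L M ul} => [|a l]; [left|right; exists a; rewrite mem_head].
- by exists [::]; rewrite l0.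
have exl : exists k, k \in l by exists k0.
case: (ex_minnP exl) => r lr rmin.
have step R g' : uniq R -> {subset R <= l} -> (0 < size R)%N ->
    matching D [seq k <- l | k \notin R] g' ->
    exists n : seq segment,
      perm_eq [seq D i | i <- l] ([seq D i | i <- R] ++ n ++ map seg_shift n).
  move=> uR sR R0 M'; have pl := perm_off ul uR sR.
  have [||||n pn] := IH [seq k <- l | k \notin R] g' => //.
  - rewrite ltnS (perm_size pl) size_cat in szl; apply: leq_trans szl.
    by rewrite -[X in (X < _)%N]add0n ltn_add2r.
  - by apply: (layout_sub L) => k; rewrite mem_filter => /andP[].
  - exact: filter_uniq.
  exists n; apply: perm_trans (perm_map _ pl) _.
  by rewrite map_cat perm_cat2l.
have [/hasP[t lt /andP[tr /eqP bt]]|/hasPn nt] :=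
  boolP (has (fun t => (t != r) && (sbeg (D t) == sbeg (D r))) l).
- have [i [j [uR sR ri tj cR]]] := peel_pair L M lr rmin lt tr bt.
  have [n pn] := step _ _ uR sR isT (matching_off M sR cR).
  exists [:: D i, D j & n]; apply: perm_trans pn _.
  rewrite /= -ri -tj; apply/permP=> P; rewrite /= !count_cat /=; lia.
- have rtop k : k \in l -> sbeg (D k) = sbeg (D r) -> k = r.
    by move=> lk bk; apply/eqP; move: (nt _ lk); rewrite bk eqxx andbT negbK.
  have [i [g' [li ir ri M']]] := peel_single L M lr rmin rtop.
  have uR : uniq [:: r; i] by rewrite /= inE eq_sym ir.
  have sR : {subset [:: r; i] <= l} by move=> k; rewrite !inE => /pred2P[]->.
  have [n pn] := step _ _ uR sR isT M'.
  exists (D i :: n); apply: perm_trans pn _.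
  rewrite /= -ri; apply/permP=> P; rewrite /= !count_cat /=; lia.
Qed.

(** * From relevant decompositions to matchings *)

Lemma seg_decomp_disjoint A ds : seg_decomp A ds ->
  pairwise (fun E E' => send E' < sbeg E) ds.
Proof.
move=> /and4P[_ _ _ so]; rewrite -sorted_pairwise.
  by apply: sub_sorted so => E E' /eqP ->; rewrite ltrBlDr ltrDl.
by move=> E2 E1 E3 h1 h2; have := seg_le E2; lia.
Qed.

Lemma seg_decomp_sub A ds E : seg_decomp A ds -> E \in ds ->
  sbeg A <= sbeg E /\ send E <= send A.
Proof.
move=> /and4P[]; case: ds => // F ds _ /= /eqP <- /eqP <-.
elim: ds F E => [|G ds IH] F E /=; first by rewrite inE => _ /eqP ->.
move=> /andP[/eqP GF so]; rewrite inE => /predU1P[->|/(IH _ _ so)[? ?]].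
  by have [h _] := IH _ _ so (mem_head G ds); have := seg_le G; lia.
by have := seg_le F; lia.
Qed.

Lemma seg_decomp_cover A ds p : seg_decomp A ds -> within A p ->
  exists2 E, E \in ds & within E p.
Proof.
move=> /and4P[]; case: ds => // F ds _ /= /eqP hd /eqP ls so.
rewrite -hd -ls => {hd ls A}.
elim: ds F so => [|G ds IH] F /=; first by exists F; rewrite ?inE.
move=> /andP[/eqP GF so] /andP[lp pF].
have [Fp|pG] := leP (sbeg F) p; first by exists F; rewrite ?mem_head ?Fp.
have [|E Eds Ep] := IH _ so; first by rewrite lp GF; lia.
by exists E; rewrite // inE Eds orbT.
Qed.

Lemma dpiece_in (k : nat) (d : 'I_k -> seq segment) (x : dindex d) :
  dpiece x \in d (tag x).
Proof. by rewrite /dpiece mem_tnth. Qed.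

Lemma dindex_eq (k : nat) (d : 'I_k -> seq segment) (x y : dindex d) :
  drow x = drow y -> dcol x = dcol y -> x = y.
Proof.
case: x y => i a [i' b]; rewrite /drow /dcol /=.
by move=> /val_inj e; case: i' / e b => b /val_inj ->.
Qed.

Lemma dec_row d0 s (d : 'I_(size s) -> seq segment) (x : dindex d) :
  order_decomp d -> seg_decomp (nth d0 s (drow x)) (d (tag x)).
Proof. by move=> dec; have := dec (tag x); rewrite (tnth_nth d0). Qed.

Lemma dpiece_sub d0 s (d : 'I_(size s) -> seq segment) (x : dindex d) :
  order_decomp d ->
  sbeg (nth d0 s (drow x)) <= sbeg (dpiece x) /\
  send (dpiece x) <= send (nth d0 s (drow x)).
Proof. by move=> dec; exact: seg_decomp_sub (dec_row d0 x dec) (dpiece_in x). Qed.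

Lemma dpiece_lt s (d : 'I_(size s) -> seq segment) (x y : dindex d) :
  order_decomp d -> drow x = drow y -> (dcol x < dcol y)%N ->
  send (dpiece y) < sbeg (dpiece x).
Proof.
case: x y => i a [i' b] dec; rewrite /drow /dcol /dpiece /=.
move=> /val_inj e; case: i' / e b => b ab.
pose d0 := tnth (in_tuple s) i.
have /(pairwiseP d0) pw := seg_decomp_disjoint (dec_row d0 (Tagged _ a) dec).
rewrite !(tnth_nth d0); apply: pw => //; exact: ltn_ord.
Qed.

Lemma dpiece_uniq s (d : 'I_(size s) -> seq segment) (x y : dindex d) p :
  order_decomp d -> drow x = drow y ->
  within (dpiece x) p -> within (dpiece y) p -> x = y.
Proof.
move=> dec e xp yp; case: (ltngtP (dcol x) (dcol y)) => [h|h|].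
- by have := dpiece_lt dec e h; lia.
- by have := dpiece_lt dec (esym e) h; lia.
- exact: dindex_eq.
Qed.

Lemma dpiece_ex d0 s (d : 'I_(size s) -> seq segment) i p :
  order_decomp d -> (i < size s)%N -> within (nth d0 s i) p ->
  exists x : dindex d, drow x = i /\ within (dpiece x) p.
Proof.
move=> dec hi ip; pose oi := Ordinal hi.
have := dec oi; rewrite (tnth_nth d0) => /seg_decomp_cover/(_ ip)[E Ed Ep].
have hE : (index E (d oi) < size (d oi))%N by rewrite index_mem.
exists (@Tagged _ oi (fun i => 'I_(size (d i))) (Ordinal hE)).
by rewrite /dpiece /= (tnth_nth d0) /= nth_index.
Qed.

(** The row of the partner of the piece through a point is the required g.
    (R1) for consecutive columns propagates to any two columns of a row; besides
    monotonicity this also excludes a piece matched within its own row, since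
    the two pieces would have to be exchanged and yet lie in strictly
    decreasing rows. *)
Lemma matching_of_relevant d0 s (d : 'I_(size s) -> seq segment) :
  order_decomp d -> relevant d -> exists g, matching (nth d0 s) (iota 0 (size s)) g.
Proof.
move=> dec [tau [tauK R1 R2 R3]].
have mono (x y : dindex d) : drow x = drow y -> (dcol x < dcol y)%N ->
    (drow (tau y) < drow (tau x))%N.
  case: x y => i a [i' b] /=; rewrite {1 2}/drow /= => /val_inj e.
  case: i' / e b => -[b hb]; rewrite {1 2}/dcol /=.
  elim: b hb => // b IH hb; rewrite ltnS leq_eqVlt => ab.
  have hb' : (b < size (d i))%N by exact: ltnW.
  have h1 := R1 (Tagged (fun i => 'I_(size (d i))) (Ordinal hb'))
                (Tagged (fun i => 'I_(size (d i))) (Ordinal hb)) erefl erefl.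
  case/predU1P: ab => [ab|ab]; last by apply: ltn_trans (IH hb' ab).
  by move: h1; congr (_ < drow (tau _))%N; apply: dindex_eq.
have neq (x : dindex d) : drow (tau x) != drow x.
  apply/eqP => e; case: (ltngtP (dcol x) (dcol (tau x))) => h.
  - by have := mono _ _ (esym e) h; rewrite tauK e ltnn.
  - by have := mono _ _ e h; rewrite tauK e ltnn.
  - by case: (R2 x); apply: dindex_eq; rewrite ?e ?h.
pose g i p := if [pick x : dindex d | (drow x == i) && within (dpiece x) p]
              is Some x then drow (tau x) else 0%N.
have gE x p : within (dpiece x) p -> g (drow x) p = drow (tau x).
  move=> xp; rewrite /g; case: pickP => [y /andP[/eqP e yp]|/(_ x)].
    by rewrite (dpiece_uniq dec e yp xp).
  by rewrite eqxx xp.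
exists g; split=> [i p|i p q|i p]; rewrite ?mem_iota add0n /= => hi ip.
- by have [x [<- xp]] := dpiece_ex dec hi ip; rewrite gE //= ltn_ord.
- move=> iq pq; have [x [ex xp]] := dpiece_ex dec hi ip.
  have [y [ey yq]] := dpiece_ex dec hi iq.
  rewrite -{1}ex -ey !gE //.
  have e : drow x = drow y by rewrite ex.
  case: (ltngtP (dcol x) (dcol y)) => h.
  + by have := dpiece_lt dec e h; lia.
  + exact: ltnW (mono _ _ (esym e) h).
  + by rewrite (dindex_eq e h).
- have [x [<- xp]] := dpiece_ex dec hi ip; rewrite gE //.
  have := neq x; rewrite neq_ltn => /orP[h|h]; [right|left].
    have e : dpiece (tau x) = seg_shift (dpiece x).
      by rewrite -{2}(tauK x); apply: R3; rewrite /dlex tauK h.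
    have tp : within (dpiece (tau x)) (p + 1) by rewrite e /sbeg /send /= !lerD2r.
    by have := dpiece_sub d0 (tau x) dec; rewrite gE // tauK; split=> //; lia.
  have e : dpiece x = seg_shift (dpiece (tau x)).
    by apply: R3; rewrite /dlex h.
  have tp : within (dpiece (tau x)) (p - 1).
    by move: xp; rewrite e /sbeg /send /= lerBrDr lerBlDr.
  by have := dpiece_sub d0 (tau x) dec; rewrite gE // tauK; split=> //; lia.
Qed.

(** * The sorted order *)

Definition seg_before (A B : segment) : bool :=
  (sbeg B < sbeg A) || (sbeg B == sbeg A) && (send A <= send B).

Lemma seg_before_total : total seg_before.
Proof. by move=> A B; rewrite /seg_before; lia. Qed.

Lemma seg_before_trans : transitive seg_before.
Proof. by move=> A B C; rewrite /seg_before; lia. Qed.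

Lemma count_beg (m : multisegment) x :
  count (fun A => sbeg A == x) m = (\sum_(A <- finsupp m | sbeg A == x) m A)%N.
Proof.
by rewrite -sum1_count sum_mset; apply: eq_bigr => A _; rewrite muln1.
Qed.

Lemma distinguished_speh (m : multisegment) :
  (forall x : int, (\sum_(D <- finsupp m | sbeg D == x) m D <= 2)%N) ->
  distinguished m -> speh_type m.
Proof.
move=> hm dm; pose s := sort seg_before m.
have ps : perm_eq s m by rewrite perm_sort.
have ss : pairwise seg_before s.
  by rewrite -(sorted_pairwise seg_before_trans) sort_sorted //; apply: seg_before_total.
have os : is_order m s by move=> A; rewrite (permP ps) count_mem_mset.
have st : standard s.
  by apply: sub_pairwise ss => A B; rewrite /seg_before /seg_prec; lia.
have [d dec rel] := dm s os st.
pose d0 := @Segment (0, 0) (lexx 0).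
have [g M] := matching_of_relevant d0 dec rel.
have nthP i j : (i < j)%N -> (j < size s)%N -> seg_before (nth d0 s i) (nth d0 s j).
  by move=> ij js; move/(pairwiseP d0): ss; apply=> //; rewrite inE //; apply: ltn_trans js.
have hb A B : seg_before A B -> sbeg B <= sbeg A by rewrite /seg_before; lia.
have L : layout (nth d0 s) (iota 0 (size s)).
  split=> [i j|i j k]; rewrite !mem_iota !add0n /=.
    by move=> _ hj ij; have := nthP i j ij hj; rewrite /seg_before; lia.
  move=> _ hj hk ij jk; rewrite ltNge; apply/negP => ik.
  have h1 := hb _ _ (nthP i j ij hj); have h2 := hb _ _ (nthP j k jk hk).
  have := hm (sbeg (nth d0 s i)); rewrite -count_beg -(permP ps).
  (* Cutting s at k, then at j, then at i exhibits three entries satisfying P. *)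
  set P := (fun A => _); rewrite leqNgt; apply/negP; rewrite negbK.
  rewrite -{1}(cat_take_drop k s) count_cat (drop_nth d0 hk) /=.
  have hj' : (j < size (take k s))%N by rewrite size_take hk.
  rewrite -{1}(cat_take_drop j (take k s)) count_cat (drop_nth d0 hj') /=.
  have hi' : (i < size (take j (take k s)))%N by rewrite size_take hj'.
  rewrite -{1}(cat_take_drop i (take j (take k s))) count_cat (drop_nth d0 hi') /=.
  have ik' := ltn_trans ij jk.
  rewrite !nth_take //.
  have -> : P (nth d0 s i) by rewrite /P.
  have -> : P (nth d0 s j) by rewrite /P eq_le h1 (le_trans ik).
  have -> : P (nth d0 s k) by rewrite /P eq_le ik (le_trans h2).
  by lia.
have [n] := matching_speh L M (iota_uniq _ _).
rewrite map_nth_iota0 // take_size => pn.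
exists (seq_mset n); apply/msetP => A.
rewrite msetE2 mseg_shiftE !mset_seqE -count_mem_mset -(permP ps) (permP pn).
rewrite count_cat count_map; congr (_ + _)%N; apply: eq_count => B /=.
exact: (can2_eq seg_shiftK seg_unshiftK).
Qed.

Theorem corollary5p6 (m : multisegment)
  (hm : forall x : int, (\sum_(D <- finsupp m | sbeg D == x) m D <= 2)%N) :
  (distinguished m -> speh_type m) /\
  (distinguished m /\ distinguished (mseg_dual m) -> speh_type m).
Proof. by split=> [|[+ _]]; apply: distinguished_speh. Qed.
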